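(* Let $\Gamma$ be a connected trivalent graph and let $G\le \mathrm{Aut}(\Gamma)$ act vertex- and arc-transitively on $\Gamma$, with infinite vertex stabilizers. Then $\Gamma$ is a tree. Furthermore, $G$ acts transitively on the set of $s$-arcs of $\Gamma$ for every $s\ge 1$, and if $G$ is a closed subgroup of $\mathrm{Aut}(\Gamma)$ then $G$ acts $2$-transitively on the set of ends of $\Gamma$.
   Context: Graphs are simple. An arc is an ordered pair $(\alpha,\beta)$ with $\{\alpha,\beta\}$ an edge. An $s$-arc is a tuple $(\alpha_0,\dots,\alpha_s)$ of vertices with each $(\alpha_i,\alpha_{i+1})$ an arc and $\alpha_{i-1}\ne\alpha_{i+1}$ for $1\le i\le s-1$. A sequence of permutations $g_i$ of a set $\Omega$ converges to a permutation $g$ if for each $\alpha\in\Omega$, $\alpha g_i=\alpha g$ for all sufficiently large $i$; a group of permutations of the vertex set is closed if it contains the limit of every convergent sequence of its elements. A ray is a one-way infinite path $\alpha_0,\alpha_1,\dots$ of distinct vertices; two rays are equivalent if some third ray meets both in infinitely many vertices; the ends of $\Gamma$ are the equivalence classes of rays, and $\mathrm{Aut}(\Gamma)$ acts on them. *)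

(* Defs.v *)
From mathcomp Require Import all_boot.
From mathcomp Require Import all_classical.
Set Implicit Arguments.
Unset Strict Implicit.
Unset Printing Implicit Defensive.
Local Open Scope classical_set_scope.
Local Open Scope card_scope.

(* The boolean adjacency relation is no restriction, since the development is
   classical: a Prop-valued relation can be reflected with asbool. *)
Record graph := Graph {
  vertex :> Type;
  adj : rel vertex;
  adj_sym : symmetric adj;
  adj_irrefl : irreflexive adj
}.

Section Graphs.
Variable Gamma : graph.
Implicit Types (x y : Gamma) (g h : Gamma -> Gamma) (G : set (Gamma -> Gamma)).

Definition neighbours x : set Gamma := [set y | adj x y].

Definition connected_graph : Prop :=
  inhabited Gamma /\
  forall x y, exists2 p : seq Gamma, path (@adj Gamma) x p & last x p = y.

Definition trivalent : Prop := forall x, neighbours x #= `I_3.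

(* ordS is the cyclic successor on 'I_n. *)
Definition is_cycle n (c : 'I_n -> Gamma) : Prop :=
  [/\ 3 <= n, injective c & forall i, adj (c i) (c (ordS i))].

Definition is_tree : Prop :=
  connected_graph /\ forall n (c : 'I_n -> Gamma), ~ is_cycle c.

Definition is_automorphism g : Prop :=
  bijective g /\ forall x y, adj (g x) (g y) = adj x y.

(* Permutations are represented by their underlying functions; by functional
   extensionality, equality of functions is equality of permutations. *)
Definition subgroup_Aut G : Prop :=
  [/\ forall g, G g -> is_automorphism g,
      G idfun,
      forall g h, G g -> G h -> G (g \o h)
    & forall g h, G g -> cancel g h -> cancel h g -> G h].

Definition stabilizer G x : set (Gamma -> Gamma) := [set g | G g /\ g x = x].

Definition vertex_transitive G : Prop :=
  forall x y, exists2 g, G g & g x = y.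

Definition arc_transitive G : Prop :=
  forall x y x' y', adj x y -> adj x' y' ->
  exists2 g, G g & g x = x' /\ g y = y'.

Definition is_sarc s (a : 'I_s.+1 -> Gamma) : Prop :=
  (forall i j : 'I_s.+1, j = i.+1 :> nat -> adj (a i) (a j)) /\
  (forall i j : 'I_s.+1, j = i.+2 :> nat -> a i <> a j).

Definition sarc_transitive G s : Prop :=
  forall a b : 'I_s.+1 -> Gamma, is_sarc a -> is_sarc b ->
  exists2 g, G g & forall i, g (a i) = b i.

Definition perm_converges (u : nat -> Gamma -> Gamma) g : Prop :=
  forall x, exists N, forall n, N <= n -> u n x = g x.

Definition closed_group G : Prop :=
  forall (u : nat -> Gamma -> Gamma) g,
  (forall n, G (u n)) -> bijective g -> perm_converges u g -> G g.

Definition is_ray (r : nat -> Gamma) : Prop :=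
  injective r /\ forall n, adj (r n) (r n.+1).

Definition ray_equiv (r1 r2 : nat -> Gamma) : Prop :=
  exists t, [/\ is_ray t, infinite_set (range t `&` range r1)
                        & infinite_set (range t `&` range r2)].

Definition end_of (r : nat -> Gamma) : set (nat -> Gamma) :=
  [set r' | is_ray r' /\ ray_equiv r r'].

Definition ends : set (set (nat -> Gamma)) := end_of @` [set r | is_ray r].

Definition end_act g (e : set (nat -> Gamma)) : set (nat -> Gamma) :=
  [set g \o r | r in e].

Definition two_transitive_on_ends G : Prop :=
  forall e1 e2 f1 f2, ends e1 -> ends e2 -> ends f1 -> ends f2 ->
  e1 <> e2 -> f1 <> f2 ->
  exists2 g, G g & end_act g e1 = f1 /\ end_act g e2 = f2.

End Graphs.

Arguments connected_graph : clear implicits.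
Arguments trivalent : clear implicits.
Arguments is_tree : clear implicits.

(* Main.v *)
Require Import Defs.
From mathcomp Require Import all_boot.
From mathcomp Require Import all_classical.
From mathcomp Require Import zify.

Set Implicit Arguments.
Unset Strict Implicit.
Unset Printing Implicit Defensive.

Local Open Scope classical_set_scope.
Local Open Scope card_scope.

(** If G is s-arc-transitive but not (s+1)-arc-transitive, the stabilizer of
    some s-arc cannot swap its two one-step prolongations at the start, so it
    fixes them. By s-arc-transitivity this holds at both ends of every s-arc, so
    by connectedness the stabilizer fixes every vertex. It is then trivial,
    while having finite index in a vertex stabilizer, which contradicts the
    infiniteness of the latter. Hence G is s-arc-transitive for all s >= 1.

    An s-arc that returns to its starting vertex can be rerouted at one endpoint
    into one that does not, so s-arc-transitivity excludes closed s-arcs: the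
    graph is a tree, and inequivalent rays have tails that are the two halves of
    a bi-infinite line. Given two such lines, s-arc-transitivity yields for each
    n an element of G matching their central segments of length 2n; by local
    finiteness these elements accumulate at a permutation matching the whole
    lines, which belongs to G when G is closed. *)

Lemma card_set2_le T (x y : T) : [set x; y] #<= `I_2.
Proof.
rewrite (_ : [set x; y] = (fun i => if i is 0 then x else y) @` `I_2).
  exact: card_image_le.
by apply/seteqP; split=> [_ [->|->]|_ [[|i] _ <-]];
  [exists 0|exists 1|left|right].
Qed.

Lemma ultra_bigcup_finite I T (U : set_system T) (D : set I) (F : I -> set T) :
  UltraFilter U -> finite_set D -> U (\bigcup_(i in D) F i) ->
  exists2 i, D i & U (F i).
Proof.
move=> UU [n]; elim: n D => [|n IH] D.
  rewrite II0 card_eq0 => /eqP->; rewrite bigcup_set0.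
  by move/(filter_not_empty U).
move=> /eq_cardSP[i Di cardDi] UD.
have [UFi|UFi] := in_ultra_setVsetC (F i) UU; first by exists i.
have [|j [Dj _] UFj] := IH _ cardDi; last by exists j.
apply: filterS (filterI UFi UD) => t [nFit [j Dj Fjt]].
by exists j => //; split=> // ij; apply: nFit; rewrite -ij.
Qed.

Lemma filter_diagonal I T (F : set_system T) (P : I -> set T) :
  ProperFilter F -> countable [set: I] -> (forall i, F (P i)) ->
  exists phi : nat -> T, forall i, exists N, forall n, N <= n -> P i (phi n).
Proof.
move=> FF /countable_injP[e e_inj] FP.
have FPn n : F [set t | forall i, e i < n -> P i t].
  elim: n => [|n IH]; first by apply: filterS filterT => t _ i.
  have [[i ein]|no_i] := pselect (exists i, e i = n).
    apply: filterS (filterI (FP i) IH) => t [Pit Pt] j.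
    rewrite ltnS leq_eqVlt => /orP[/eqP ejn|/Pt//].
    by rewrite (e_inj j i) ?inE // ejn ein.
  apply: filterS IH => t Pt j; rewrite ltnS leq_eqVlt => /orP[/eqP ejn|/Pt//].
  by case: no_i; exists j.
have [phi phiP] := choice (fun n => filter_ex (FPn n)).
by exists phi => i; exists (e i).+1 => n /phiP.
Qed.

Section Valency.
Variable Gamma : graph.
Implicit Types (x y z w a b c : Gamma) (A : set Gamma).

Definition min_degree d : Prop := forall x, `I_d #<= neighbours x.

Definition locally_finite : Prop := forall x, finite_set (neighbours x).

Lemma min_degreeW d d' : d' <= d -> min_degree d -> min_degree d'.
Proof.
by move=> d'd deg x; apply: card_le_trans (deg x); rewrite card_le_II.
Qed.

Lemma trivalent_min_degree : trivalent Gamma -> min_degree 3.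
Proof. by move=> tri x; move: (tri x); rewrite card_eq_le => /andP[]. Qed.

Lemma trivalent_locally_finite : trivalent Gamma -> locally_finite.
Proof. by move=> tri x; exists 3. Qed.

Lemma trivalent_neighbours x a b c : trivalent Gamma ->
  adj x a -> adj x b -> adj x c -> a <> b -> a <> c -> b <> c ->
  neighbours x = [set a; b; c].
Proof.
move=> tri xa xb xc ab ac bc.
apply/seteqP; split=> [y xy|_ [[->|->]|->] //].
have /card_set_bijP[F [F3 F_inj _]] := tri x.
have F_neq u v : adj x u -> adj x v -> u <> v -> F u <> F v.
  by move=> xu xv uv Fuv; apply/uv/F_inj; rewrite ?inE.
have [->|/F_neq Fya] := pselect (y = a); first by left; left.
have [->|/F_neq Fyb] := pselect (y = b); first by left; right.
have [->|/F_neq Fyc] := pselect (y = c); first by right.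
move: (F_neq a b xa xb ab) (F_neq a c xa xc ac) (F_neq b c xb xc bc).
move: (Fya xy xa) (Fyb xy xb) (Fyc xy xc).
by move: (F3 a xa) (F3 b xb) (F3 c xc) (F3 y xy) => /=; lia.
Qed.

Lemma neighbour_notin d x A : min_degree d.+1 -> A #<= `I_d ->
  exists2 w, adj x w & ~ A w.
Proof.
move=> deg cardA; apply: contrapT => no_w.
have : neighbours x `<=` A.
  by move=> w xw; apply: contrapT => nAw; apply: no_w; exists w.
move=> /subset_card_le nb_leA.
have := card_le_trans (deg x) (card_le_trans nb_leA cardA).
by rewrite card_le_II ltnn.
Qed.

Lemma neighbour_neq x y : min_degree 2 -> exists2 w, adj x w & w <> y.
Proof.
move=> deg; apply: (neighbour_notin x deg (A := [set y])).
by have := @card_set1 _ y; rewrite card_eq_le => /andP[].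
Qed.

Lemma neighbour_neq2 x y z : min_degree 3 ->
  exists2 w, adj x w & w <> y /\ w <> z.
Proof.
move=> deg; have [w xw] := neighbour_notin x deg (card_set2_le y z).
by move/not_orP; exists w.
Qed.

End Valency.

Section Connectedness.
Variable Gamma : graph.
Hypothesis Gamma_connected : connected_graph Gamma.

Lemma connected_ind (P : Gamma -> Prop) x0 : P x0 ->
  (forall x y, P x -> adj x y -> P y) -> forall x, P x.
Proof.
move=> P0 PS x; have [p + <-] := Gamma_connected.2 x0 x.
by elim: p x0 P0 => //= y p IH x0 Px0 /andP[x0y]; apply: IH; apply: PS x0y.
Qed.

Lemma connected_countable :
  (forall x : Gamma, countable (neighbours x)) -> countable [set: Gamma].
Proof.
have [[x0] _] := Gamma_connected; move=> nb_countable.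
pose sphere n := iter n (fun A => \bigcup_(x in A) neighbours x) [set x0].
rewrite (_ : setT = \bigcup_n sphere n).
  apply: bigcup_countable => // n _.
  elim: n => [|n IH]; first exact: countable1.
  exact: bigcup_countable.
apply/seteqP; split=> // x _; move: x.
apply: (@connected_ind _ x0); first by exists 0.
by move=> x y [n _ xn] xy; exists n.+1 => //; exists x.
Qed.

End Connectedness.

Section Walks.
Variable Gamma : graph.
Implicit Types (w : Gamma) (f h : nat -> Gamma) (g : Gamma -> Gamma).

(* An s-arc, encoded as the first s + 1 values of a sequence. *)
Definition nbwalk s f : Prop :=
  (forall i, i < s -> adj (f i) (f i.+1)) /\
  (forall i, i.+1 < s -> f i <> f i.+2).

Definition walk_cons w f i : Gamma := if i is j.+1 then f j else w.

(* f m, ..., f 1, h 0, h 1, ... *)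
Fixpoint walk_rev_cat m f h : nat -> Gamma :=
  if m is k.+1 then walk_cons (f m) (walk_rev_cat k f h) else h.

Lemma nbwalk_le t s f : t <= s -> nbwalk s f -> nbwalk t f.
Proof.
by move=> ts [f_adj f_nb]; split=> i lt_it; [apply: f_adj|apply: f_nb]; lia.
Qed.

Lemma eq_nbwalk s f h :
  (forall i, i <= s -> f i = h i) -> nbwalk s f -> nbwalk s h.
Proof.
move=> fh [f_adj f_nb]; split=> i lt_is.
  by rewrite -!fh ?(ltnW lt_is) //; apply: f_adj.
by rewrite -!fh //; [apply: f_nb|lia].
Qed.

Lemma nbwalk_shift k s f : nbwalk (k + s) f -> nbwalk s (fun i => f (k + i)).
Proof.
move=> [f_adj f_nb].
by split=> i lt_is; rewrite !addnS; [apply: f_adj|apply: f_nb]; lia.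
Qed.

Lemma nbwalk_rev s f : nbwalk s f -> nbwalk s (fun i => f (s - i)).
Proof.
move=> [f_adj f_nb]; split=> i lt_is.
  by rewrite adj_sym (_ : s - i = (s - i.+1).+1); [apply: f_adj|]; lia.
by apply/nesym; rewrite (_ : s - i = (s - i.+2).+2); [apply: f_nb|]; lia.
Qed.

Lemma nbwalk_cons s w f : nbwalk s f -> adj w (f 0) -> (0 < s -> w <> f 1) ->
  nbwalk s.+1 (walk_cons w f).
Proof.
move=> [f_adj f_nb] wf0 wf1; split=> -[|i] /= lt_is //; first exact: f_adj.
  exact: wf1.
exact: f_nb.
Qed.

Lemma nbwalk_comp s g f : is_automorphism g -> nbwalk s f -> nbwalk s (g \o f).
Proof.
move=> [/bij_inj g_inj g_adj] [f_adj f_nb]; split=> i lt_is /=.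
  by rewrite g_adj f_adj.
by move/g_inj; apply: f_nb.
Qed.

Lemma walk_rev_catl m f h i : f 0 = h 0 -> i <= m ->
  walk_rev_cat m f h (m - i) = f i.
Proof.
move=> fh0; elim: m => [|m IH]; first by rewrite leqn0 => /eqP->.
rewrite leq_eqVlt => /orP[/eqP->|im]; first by rewrite subnn.
by rewrite subSn //= IH.
Qed.

Lemma walk_rev_catr m f h i : walk_rev_cat m f h (m + i) = h i.
Proof. by elim: m. Qed.

Lemma nbwalk_rev_cat m n f h : nbwalk m f -> nbwalk n h -> f 0 = h 0 ->
  f 1 <> h 1 -> nbwalk (m + n) (walk_rev_cat m f h).
Proof.
move=> fP hP fh0 fh1; elim: m fP => // m IH fP /=.
have [f_adj f_nb] := fP.
apply: nbwalk_cons; first exact/IH/(nbwalk_le _ fP).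
  by rewrite -(subnn m) walk_rev_catl // adj_sym f_adj.
case: m {IH fP f_adj} f_nb => // m f_nb _.
by rewrite -(subSnn m) walk_rev_catl //; apply/nesym/f_nb.
Qed.

End Walks.

Section AutomorphismGroups.
Variable Gamma : graph.
Implicit Types (x y w : Gamma) (f h : nat -> Gamma) (g : Gamma -> Gamma).
Implicit Type G : set (Gamma -> Gamma).

Lemma automorphism_inj g : is_automorphism g -> injective g.
Proof. by case=> /bij_inj. Qed.

Lemma automorphism_inv g g' : is_automorphism g -> cancel g g' -> cancel g' g ->
  is_automorphism g'.
Proof.
move=> [_ g_adj] gK g'K; split; first by exists g.
by move=> x y; rewrite -g_adj !g'K.
Qed.

Lemma subgroup_automorphism G g : subgroup_Aut G -> G g -> is_automorphism g.
Proof. by case=> + _ _ _; apply. Qed.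

Lemma subgroup_adj G g x y : subgroup_Aut G -> G g -> adj (g x) (g y) = adj x y.
Proof. by move=> subG /(subgroup_automorphism subG)[]. Qed.

Lemma subgroup_inv G g : subgroup_Aut G -> G g ->
  exists g', [/\ G g', cancel g g' & cancel g' g].
Proof.
move=> subG Gg; have [[g' gK g'K] _] := subgroup_automorphism subG Gg.
by exists g'; split=> //; case: subG => _ _ _; apply; [exact: Gg|..].
Qed.

Lemma subgroup_comp G g g' : subgroup_Aut G -> G g -> G g' -> G (g \o g').
Proof. by case=> _ _ + _; apply. Qed.

Lemma stabilizer_subgroup G x : subgroup_Aut G -> subgroup_Aut (stabilizer G x).
Proof.
move=> [G_aut G1 GM GV]; split=> //.
- by move=> g [/G_aut].
- by move=> g h [Gg gx] [Gh hx]; split; [exact: GM|rewrite /= hx gx].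
- by move=> g h [Gg gx] gK hK; split; [exact: GV gK hK|rewrite -{1}gx gK].
Qed.

Lemma finite_orbit_stabilizer G x : subgroup_Aut G ->
  finite_set [set g x | g in G] -> finite_set (stabilizer G x) -> finite_set G.
Proof.
move=> subG orbit_fin stab_fin.
apply: (@sub_finite_set _ _ (\bigcup_(y in [set g x | g in G])
    [set g | G g /\ g x = y])).
  by move=> g Gg; exists (g x) => //; exists g.
apply: bigcup_finite => // _ [g0 Gg0 <-].
have [g1 [Gg1 g0K g1K]] := subgroup_inv subG Gg0.
apply: (sub_finite_set _ (finite_image (fun g => g0 \o g) stab_fin)).
move=> g [Gg gx]; exists (g1 \o g); last by apply: funext => y /=; rewrite g1K.
by split; [exact: subgroup_comp|rewrite /= gx g0K].
Qed.

Definition walk_stabilizer G s f : set (Gamma -> Gamma) :=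
  [set g | G g /\ forall i, i <= s -> g (f i) = f i].

Lemma walk_stabilizer_adj G s f g i w : subgroup_Aut G ->
  walk_stabilizer G s f g -> i <= s -> adj (f i) (g w) = adj (f i) w.
Proof.
move=> subG [Gg gf] le_is.
by rewrite -[in LHS](gf i) // (subgroup_adj _ _ subG Gg).
Qed.

Lemma walk_stabilizer0 G f : walk_stabilizer G 0 f = stabilizer G (f 0).
Proof.
apply/seteqP; split=> g [Gg gf]; split=> //; first exact: gf.
by move=> i; rewrite leqn0 => /eqP->.
Qed.

Lemma walk_stabilizerS G s f :
  walk_stabilizer G s.+1 f = stabilizer (walk_stabilizer G s f) (f s.+1).
Proof.
apply/seteqP; split=> [g [Gg gf]|g [[Gg gf] gfs]].
  by split; [split=> // i le_is; apply/gf/leqW|exact: gf].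
by split=> // i; rewrite leq_eqVlt => /orP[/eqP->|/gf].
Qed.

Lemma walk_stabilizer_subgroup G s f :
  subgroup_Aut G -> subgroup_Aut (walk_stabilizer G s f).
Proof.
move=> subG; elim: s => [|s IH]; rewrite ?walk_stabilizer0 ?walk_stabilizerS;
exact: stabilizer_subgroup.
Qed.

Lemma infinite_walk_stabilizer G s f : locally_finite Gamma -> subgroup_Aut G ->
  nbwalk s f -> infinite_set (stabilizer G (f 0)) ->
  infinite_set (walk_stabilizer G s f).
Proof.
move=> fin subG fP stab_inf; elim: s fP => [|s IH] fP.
  by rewrite walk_stabilizer0.
rewrite walk_stabilizerS => stab_fin; apply: (IH (nbwalk_le (leqnSn s) fP)).
apply: finite_orbit_stabilizer (walk_stabilizer_subgroup s f subG) _ stab_fin.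
apply: (sub_finite_set _ (fin (f s))) => _ [g gS <-].
by rewrite /neighbours /= (walk_stabilizer_adj _ subG gS) //; apply: fP.1.
Qed.

Definition nbwalk_transitive G s : Prop :=
  forall f h, nbwalk s f -> nbwalk s h ->
  exists2 g, G g & forall i, i <= s -> g (f i) = h i.

Lemma sarc_transitiveP G s : sarc_transitive G s <-> nbwalk_transitive G s.
Proof.
split=> [tr f h [fa fb] [ha hb]|tr a b aP bP].
  have [||g Gg gE] := tr (fun i : 'I_s.+1 => f i) (fun i : 'I_s.+1 => h i).
  - by split=> i [j js] /= ji; subst j; [apply: fa|apply: fb]; lia.
  - by split=> i [j js] /= ji; subst j; [apply: ha|apply: hb]; lia.
  by exists g => // i si; exact: (gE (Ordinal (si : i < s.+1))).
have walk (c : 'I_s.+1 -> Gamma) : is_sarc c -> nbwalk s (fun i => c (inord i)).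
  move=> [ca cb].
  by split=> i lt_is; [apply: ca|apply: cb]; rewrite !inordK; lia.
have [g Gg gE] := tr _ _ (walk a aP) (walk b bP).
by exists g => // i; have := gE i; rewrite inord_val; apply; rewrite -ltnS.
Qed.

Lemma arc_transitive_nbwalk G : arc_transitive G -> nbwalk_transitive G 1.
Proof.
move=> arc_tr f h [f_adj _] [h_adj _].
have [g Gg [g0 g1]] := arc_tr _ _ _ _ (f_adj 0 isT) (h_adj 0 isT).
by exists g => // -[|[|//]].
Qed.

Lemma nbwalk_transitiveS G s : subgroup_Aut G -> nbwalk_transitive G s ->
  (forall f a b, nbwalk s.+1 (walk_cons a f) -> nbwalk s.+1 (walk_cons b f) ->
    exists2 g, walk_stabilizer G s f g & g a = b) ->
  nbwalk_transitive G s.+1.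
Proof.
move=> subG tr ext_tr f h fP hP.
have [g Gg gE] := tr _ _ (nbwalk_shift (k := 1) fP) (nbwalk_shift (k := 1) hP).
have [||g' [Gg' g'E] g'f0] := ext_tr (fun i => h (1 + i)) (g (f 0)) (h 0).
- apply: eq_nbwalk (nbwalk_comp (subgroup_automorphism subG Gg) fP).
  by case=> // i le_is; exact: gE.
- by apply: eq_nbwalk hP; case.
exists (g' \o g); first exact: subgroup_comp.
by move=> [|i] //= le_is; rewrite (gE i) // g'E.
Qed.

End AutomorphismGroups.

Section RigidWalks.
Variables (Gamma : graph) (G : set (Gamma -> Gamma)).
Hypothesis subG : subgroup_Aut G.
Implicit Types (w a b : Gamma) (f h : nat -> Gamma) (g : Gamma -> Gamma).

Definition rigid_walk s f : Prop :=
  forall g, walk_stabilizer G s f g -> forall w, adj (f 0) w -> g w = w.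

Lemma trivalent_rigid_walk s f a b : trivalent Gamma -> 0 < s ->
  nbwalk s.+1 (walk_cons a f) -> nbwalk s.+1 (walk_cons b f) ->
  (forall g, walk_stabilizer G s f g -> g a <> b) -> rigid_walk s f.
Proof.
move=> tri s_gt0 [a_adj a_nb] [b_adj b_nb] no_swap.
have ab : a <> b by apply: (no_swap idfun); split=> //; case: subG.
have af1 : a <> f 1 by apply: (a_nb 0).
have bf1 : b <> f 1 by apply: (b_nb 0).
have nbE : neighbours (f 0) = [set a; b; f 1].
  apply: trivalent_neighbours => //; last exact: (a_adj 1).
    by rewrite adj_sym (a_adj 0).
  by rewrite adj_sym (b_adj 0).
move=> g gS; have [Gg gf] := gS.
have g_inj := automorphism_inj (subgroup_automorphism subG Gg).
have gf1 : g (f 1) = f 1 by exact: gf.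
have g_nb w : [set a; b; f 1] w -> [set a; b; f 1] (g w).
  by rewrite -nbE /neighbours /= (walk_stabilizer_adj _ subG gS).
have ga : g a = a.
  have [[//|/no_swap//]|] : [set a; b; f 1] (g a) by apply: g_nb; left; left.
  by rewrite -gf1 => /g_inj.
have gb : g b = b.
  have [[|//]|] : [set a; b; f 1] (g b) by apply: g_nb; left; right.
    by rewrite -ga => /g_inj/esym.
  by rewrite -gf1 => /g_inj.
by move=> w fw; have : neighbours (f 0) w by []; rewrite nbE => -[[|]|] ->.
Qed.

Lemma nbwalk_transitive_rigid_walk s f h : nbwalk_transitive G s ->
  nbwalk s f -> nbwalk s h -> rigid_walk s f -> rigid_walk s h.
Proof.
move=> tr fP hP fR g [Gg gh] w hw.
have [k Gk kE] := tr _ _ fP hP.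
have [k' [Gk' kK k'K]] := subgroup_inv subG Gk.
apply: (can_inj k'K); rewrite -[in LHS](k'K w).
apply: (fR (k' \o (g \o k))).
  split=> [|i le_is /=]; first by do 2!apply: subgroup_comp => //.
  by rewrite kE // gh // -kE // kK.
by rewrite -(subgroup_adj _ _ subG Gk) k'K kE.
Qed.

Section FixedWalks.
Variables (s : nat) (g : Gamma -> Gamma).
Hypotheses (s_gt0 : 0 < s) (rigid : forall f, nbwalk s f -> rigid_walk s f).

Definition fixed_nbwalk f : Prop := nbwalk s f /\ walk_stabilizer G s f g.

Lemma fixed_nbwalk_rev f : fixed_nbwalk f -> fixed_nbwalk (fun i => f (s - i)).
Proof.
move=> [fP [Gg gf]]; split; first exact: nbwalk_rev.
by split=> // i _; apply: gf; exact: leq_subr.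
Qed.

Lemma fixed_nbwalk_cons w f : fixed_nbwalk f -> adj (f 0) w -> w <> f 1 ->
  fixed_nbwalk (walk_cons w f).
Proof.
move=> [fP gS] fw wf1; have [Gg gf] := gS; split.
  apply: (@nbwalk_le _ _ s.+1) => //.
  by apply: nbwalk_cons; rewrite // adj_sym.
split=> // -[|i] lt_is /=; first exact: rigid gS _ fw.
by apply: gf; exact: ltnW.
Qed.

(* Prolonging the reversed walk drops the starting vertex at its far end. *)
Lemma fixed_nbwalk_behead f : min_degree Gamma 2 -> fixed_nbwalk f ->
  exists2 h, fixed_nbwalk h & h 0 = f 1.
Proof.
move=> deg fP.
have [w fw wf] := neighbour_neq (f s) (f s.-1) deg.
exists (fun i => walk_cons w (fun i => f (s - i)) (s - i)).
  by apply/fixed_nbwalk_rev/fixed_nbwalk_cons;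
    [exact: fixed_nbwalk_rev|rewrite subn0|rewrite subn1].
by rewrite subn0 -(prednK s_gt0) /= subSnn.
Qed.

Lemma fixed_nbwalk_id f : connected_graph Gamma -> min_degree Gamma 2 ->
  fixed_nbwalk f -> g = idfun.
Proof.
move=> conn deg fP; apply: funext => x.
suff [h [_ [_ gh]] <-] : exists2 h, fixed_nbwalk h & h 0 = x by exact: gh.
move: x; apply: (connected_ind conn (x0 := f 0)); first by exists f.
move=> _ w [h hP <-] hw.
have [->|wh1] := pselect (w = h 1); first exact: fixed_nbwalk_behead.
by exists (walk_cons w h) => //; exact: fixed_nbwalk_cons.
Qed.

End FixedWalks.

Lemma trivalent_nbwalk_transitive s :
  connected_graph Gamma -> trivalent Gamma -> arc_transitive G ->
  (forall x, infinite_set (stabilizer G x)) ->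
  0 < s -> nbwalk_transitive G s.
Proof.
move=> conn tri arc_tr stab_inf.
case: s => // s _; elim: s => [|s IH]; first exact: arc_transitive_nbwalk.
apply: nbwalk_transitiveS => // f a b aP bP; apply: contrapT => no_g.
have fP : nbwalk s.+1 f by exact: (nbwalk_shift (k := 1) aP).
have fR : rigid_walk s.+1 f.
  apply: (trivalent_rigid_walk _ _ aP bP) => // g gS gab.
  by apply: no_g; exists g.
have rigid h : nbwalk s.+1 h -> rigid_walk s.+1 h.
  by move=> hP; exact: nbwalk_transitive_rigid_walk IH fP hP fR.
have fin := trivalent_locally_finite tri.
apply: (infinite_walk_stabilizer fin subG fP (stab_inf _)).
apply: (sub_finite_set _ (finite_set1 idfun)) => g gS.
have deg := min_degreeW (isT : 2 <= 3) (trivalent_min_degree tri).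
exact: (fixed_nbwalk_id (ltn0Sn s) rigid conn deg (conj fP gS)).
Qed.

End RigidWalks.

Section Trees.
Variable Gamma : graph.
Implicit Type f : nat -> Gamma.

Lemma closed_nbwalk_has_cycle s f : 0 < s -> nbwalk s f -> f 0 = f s ->
  exists n (c : 'I_n -> Gamma), is_cycle c.
Proof.
have [m] := ubnP s; elim: m s f => // m IH s f sm s_gt0 fP f0s.
have [[i [j [ij js fij]]]|no_repeat] :=
    pselect (exists i j, [/\ i < j, j < s & f i = f j]).
  apply: (IH (j - i) (fun n => f (i + n))); [lia|lia| |].
    by apply/nbwalk_shift/(nbwalk_le _ fP); lia.
  by rewrite addn0 subnKC // ltnW.
have [f_adj f_nb] := fP; exists s, (fun i : 'I_s => f i); split.
- have [s_eq1|s_neq1] := eqVneq s 1.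
    by have := f_adj 0 s_gt0; rewrite f0s s_eq1 adj_irrefl.
  have [s_eq2|s_neq2] := eqVneq s 2; last by lia.
  by case: (f_nb 0); rewrite ?f0s s_eq2.
- move=> i j fij; apply/val_inj/eqP; case: ltngtP => // ij; case: no_repeat.
    by exists i, j.
  by exists j, i.
- move=> [i lt_is] /=; have [si|si] := ltnP i.+1 s.
    by rewrite modn_small //; exact: f_adj.
  have -> : i.+1 = s by lia.
  by rewrite modnn f0s (_ : s = i.+1); [exact: f_adj|lia].
Qed.

Lemma cycle_closed_nbwalk n (c : 'I_n -> Gamma) : is_cycle c ->
  exists2 f : nat -> Gamma, nbwalk n f & f 0 = f n.
Proof.
move=> [n3 c_inj c_adj]; have n_gt0 : 0 < n by lia.
pose f i := c (Ordinal (ltn_pmod i n_gt0)).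
exists f; last by congr c; apply: val_inj; rewrite /= modnn mod0n.
split=> i lt_is.
  suff -> : f i.+1 = c (ordS (Ordinal (ltn_pmod i n_gt0))) by exact: c_adj.
  by congr c; apply: val_inj; rewrite /= -addn1 -modnDml addn1.
move/c_inj/(congr1 val) => /=; rewrite modn_small; last lia.
have [e|ne] := eqVneq i.+2 n; first by rewrite e modnn; lia.
by rewrite modn_small; lia.
Qed.

Lemma is_treeP : is_tree Gamma <-> connected_graph Gamma /\
  forall s (f : nat -> Gamma), 0 < s -> nbwalk s f -> f 0 <> f s.
Proof.
split=> -[conn acyclic]; split=> //.
  move=> s f s_gt0 fP /(closed_nbwalk_has_cycle s_gt0 fP)[n [c]].
  exact: acyclic.
move=> n c cP; have [f fP] := cycle_closed_nbwalk cP.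
by apply: acyclic fP; case: cP => n3 _ _; lia.
Qed.

Lemma nbwalk_transitive_not_closed (G : set (Gamma -> Gamma)) s f :
  min_degree Gamma 3 -> 0 < s -> nbwalk_transitive G s -> nbwalk s f ->
  f 0 <> f s.
Proof.
move=> deg; case: s => // s _ tr fP f0s.
have [w fw [wf0 wf2]] := neighbour_neq2 (f 1) (f 0) (f 2) deg.
have wP : nbwalk s.+1 (walk_cons w (fun i => f (1 + i))).
  by apply: nbwalk_cons; rewrite 1?adj_sym //; exact: nbwalk_shift.
have [g _ gE] := tr _ _ fP wP.
by apply: wf0; rewrite -[LHS](gE 0) // f0s gE.
Qed.

Lemma nbwalk_transitive_is_tree (G : set (Gamma -> Gamma)) :
  connected_graph Gamma -> min_degree Gamma 3 ->
  (forall s, 0 < s -> nbwalk_transitive G s) -> is_tree Gamma.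
Proof.
move=> conn deg tr; apply/is_treeP; split=> // s f s_gt0.
exact: (nbwalk_transitive_not_closed deg s_gt0 (tr s s_gt0)).
Qed.

End Trees.

Section Rays.
Variable Gamma : graph.
Implicit Types (x : Gamma) (f h k r : nat -> Gamma) (g : Gamma -> Gamma).

Definition same_tail f h : Prop := exists a b, forall n, f (a + n) = h (b + n).

(* The two halves of a bi-infinite non-backtracking line. *)
Definition opposite_rays f h : Prop :=
  [/\ is_ray f, is_ray h, f 0 = h 0 & f 1 <> h 1].

Lemma same_tail_sym f h : same_tail f h -> same_tail h f.
Proof. by move=> [a [b e]]; exists b, a => n; rewrite e. Qed.

Lemma same_tail_trans f h k : same_tail f h -> same_tail h k -> same_tail f k.
Proof.
move=> [a [b fh]] [c [d hk]]; exists (a + c), (d + b) => n.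
by rewrite -addnA fh addnCA hk addnA.
Qed.

Lemma same_tail_shift a f : same_tail f (fun n => f (a + n)).
Proof. by exists a, 0. Qed.

Lemma same_tail_cons x f : same_tail f (walk_cons x f).
Proof. by exists 0, 1. Qed.

Lemma ray_nbwalk s f : is_ray f -> nbwalk s f.
Proof. by move=> [f_inj f_adj]; split=> // i _ /f_inj; lia. Qed.

Lemma ray_shift a f : is_ray f -> is_ray (fun n => f (a + n)).
Proof.
move=> [f_inj f_adj]; split=> [i j /f_inj/addnI //|n].
by rewrite addnS; exact: f_adj.
Qed.

Lemma ray_comp g f : is_automorphism g -> is_ray f -> is_ray (g \o f).
Proof.
move=> g_aut [f_inj f_adj]; split=> [|n /=]; last by rewrite g_aut.2.
exact: inj_comp (automorphism_inj g_aut) f_inj.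
Qed.

Lemma infinite_range_ray f : is_ray f -> infinite_set (range f).
Proof.
move=> [f_inj _].
by rewrite (eq_finite_set (inj_card_eq (in2W f_inj))); exact: infinite_nat.
Qed.

Lemma ray_equiv_comp g f h : is_automorphism g -> ray_equiv f h ->
  ray_equiv (g \o f) (g \o h).
Proof.
move=> g_aut [t [t_ray tf th]].
have meet k : infinite_set (range t `&` range k) ->
    infinite_set (range (g \o t) `&` range (g \o k)).
  have g_inj := automorphism_inj g_aut.
  rewrite -(eq_finite_set (inj_card_eq (f := g) (in2W g_inj))).
  apply: sub_infinite_set => _ [_ [[m _ <-] [n _ nm]] <-].
  by split; [exists m|exists n => //=; rewrite nm].
by exists (g \o t); split; [exact: ray_comp|exact: meet|exact: meet].
Qed.

Lemma end_act_end_of g r :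
  is_automorphism g -> end_act g (end_of r) = end_of (g \o r).
Proof.
move=> g_aut; have [[g' gK g'K] _] := g_aut.
have g'_aut := automorphism_inv g_aut gK g'K.
apply/seteqP; split=> [_ [h [h_ray rh] <-]|h [h_ray rh]].
  by split; [exact: ray_comp|exact: ray_equiv_comp].
exists (g' \o h); last by apply: funext => n /=; rewrite g'K.
split; first exact: ray_comp.
have := ray_equiv_comp g'_aut rh; congr ray_equiv.
by apply: funext => n /=; rewrite gK.
Qed.

End Rays.

Section RaysInTrees.
Variable Gamma : graph.
Hypothesis Gamma_tree : is_tree Gamma.
Implicit Types (x : Gamma) (f h k : nat -> Gamma).

Lemma tree_nbwalk_not_closed s f : 0 < s -> nbwalk s f -> f 0 <> f s.
Proof. by have [_] := (is_treeP Gamma).1 Gamma_tree; apply. Qed.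

Lemma tree_rayP f : is_ray f <-> forall s, nbwalk s f.
Proof.
split=> [f_ray s|fP]; first exact: ray_nbwalk.
split=> [|n]; last exact: (fP n.+1).1.
have f_neq i j : i < j -> f i <> f j.
  move=> ij; have := @tree_nbwalk_not_closed (j - i) (fun n => f (i + n)).
  rewrite addn0 subnKC ?(ltnW ij) //.
  by apply; [lia|exact: nbwalk_shift].
by move=> i j fij; case: (ltngtP i j) => // /f_neq; rewrite fij.
Qed.

Lemma ray_from_vertex x f :
  is_ray f -> exists h, [/\ is_ray h, h 0 = x & same_tail f h].
Proof.
move=> f_ray; move: x; apply: (connected_ind Gamma_tree.1 (x0 := f 0)).
  by exists f; split=> //; exact: (same_tail_shift 0).
move=> _ y [h [h_ray <- fh]] hy.
have [->|yh1] := pselect (y = h 1).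
  exists (fun n => h (1 + n)); split=> //; first exact: ray_shift.
  exact: same_tail_trans fh (same_tail_shift _ _).
exists (walk_cons y h); split=> //; last first.
  exact: same_tail_trans fh (same_tail_cons _ _).
apply/tree_rayP => s; apply: (nbwalk_le (leqnSn s)).
by apply: nbwalk_cons; rewrite 1?adj_sym //; exact: ray_nbwalk.
Qed.

Lemma opposite_rays_same_tail f h : is_ray f -> is_ray h -> ~ same_tail f h ->
  exists p q, [/\ opposite_rays p q, same_tail f p & same_tail h q].
Proof.
move=> f_ray h_ray nfh.
have [k [k_ray kf0 hk]] := ray_from_vertex (f 0) h_ray.
have fk_neq : exists n, ~~ `[<f n = k n>].
  apply: contrapT => fk_eq; apply: nfh.
  apply: same_tail_trans (same_tail_sym hk); exists 0, 0 => n.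
  by apply: contrapT => fkn; apply: fk_eq; exists n; exact/asboolPn.
case: (ex_minnP fk_neq) => -[|m] /asboolPn fkm m_min; first by case: fkm.
have fkm' : f m = k m by apply: contrapT => /asboolPn/m_min; rewrite ltnn.
exists (fun n => f (m + n)), (fun n => k (m + n)); split.
- by split; [exact: ray_shift|exact: ray_shift|rewrite !addn0|rewrite addn1].
- exact: same_tail_shift.
- exact: same_tail_trans hk (same_tail_shift _ _).
Qed.

Lemma opposite_rays_disjoint f h i j : opposite_rays f h -> f i = h j ->
  i = 0 /\ j = 0.
Proof.
move=> [f_ray h_ray fh0 fh1] fhij.
have [|ij] := posnP (i + j); first by lia.
have walkP := nbwalk_rev_cat (ray_nbwalk i f_ray) (ray_nbwalk j h_ray) fh0 fh1.
have := tree_nbwalk_not_closed ij walkP.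
by rewrite walk_rev_catr -{1}(subnn i) walk_rev_catl.
Qed.

Lemma infinite_meet_same_tail f h : is_ray f -> is_ray h ->
  infinite_set (range f `&` range h) -> same_tail f h.
Proof.
move=> f_ray h_ray; apply: contra_notP => nfh.
have [p [q [pq [a [b fp]] [c [d hq]]]]] :=
  opposite_rays_same_tail f_ray h_ray nfh.
apply: (@sub_finite_set _ _ (f @` `I_a `|` h @` `I_c `|` [set p 0])).
  move=> _ [[i _ <-] [j _ fhij]].
  have [ia|ai] := ltnP i a; first by left; left; exists i.
  have [jc|cj] := ltnP j c; first by left; right; exists j.
  right; move: fhij; rewrite -(subnKC ai) -(subnKC cj) fp hq => /esym.
  by case/(opposite_rays_disjoint pq) => ->.
by rewrite !finite_setU; split; [split|];
  [exact: finite_image|exact: finite_image|exact: finite_set1].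
Qed.

Lemma ray_equivP f h : is_ray f -> is_ray h -> ray_equiv f h <-> same_tail f h.
Proof.
move=> f_ray h_ray; split=> [[t [t_ray tf th]]|[a [b fh]]].
  apply: (@same_tail_trans _ _ t); last exact: infinite_meet_same_tail.
  by apply: same_tail_sym; apply: infinite_meet_same_tail.
exists f; split=> //; first by rewrite setIid; apply: infinite_range_ray.
apply: (sub_infinite_set _ (infinite_range_ray (ray_shift a f_ray))).
by move=> _ [n _ <-]; split; [exists (a + n)|exists (b + n)].
Qed.

Lemma end_of_same_tail f h : is_ray f -> is_ray h -> same_tail f h ->
  end_of f = end_of h.
Proof.
move=> f_ray h_ray fh; apply/seteqP; split=> k [k_ray] /ray_equivP equiv;
split=> //; apply/ray_equivP => //.
  exact: same_tail_trans (same_tail_sym fh) (equiv f_ray k_ray).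
exact: same_tail_trans fh (equiv h_ray k_ray).
Qed.

Lemma distinct_ends_opposite_rays e e' : @ends Gamma e -> ends e' -> e <> e' ->
  exists p q, [/\ opposite_rays p q, e = end_of p & e' = end_of q].
Proof.
move=> [r r_ray <-] [t t_ray <-] rt.
have nrt : ~ same_tail r t by move/(end_of_same_tail r_ray t_ray).
have [p [q [pq rp tq]]] := opposite_rays_same_tail r_ray t_ray nrt.
have [p_ray q_ray _ _] := pq.
by exists p, q; split=> //; exact: end_of_same_tail.
Qed.

End RaysInTrees.

Section PointwiseLimits.
Variables (Gamma : graph) (I : Type) (U : set_system I).
Context {UU : UltraFilter U}.
Hypotheses (Gamma_connected : connected_graph Gamma)
  (Gamma_locally_finite : locally_finite Gamma).
Implicit Types (x y : Gamma) (u : I -> Gamma -> Gamma) (g : Gamma -> Gamma).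

Lemma ultra_limit_exists u x0 y0 :
  (forall i x y, adj (u i x) (u i y) = adj x y) -> (forall i, u i x0 = y0) ->
  exists g, forall x, U [set i | u i x = g x].
Proof.
move=> u_adj u0; suff /choice[g gU] : forall x, exists y, U [set i | u i x = y].
  by exists g.
apply: (connected_ind Gamma_connected (x0 := x0)).
  by exists y0; apply: filterS filterT => i _; exact: u0.
move=> x z [y Uy] xz.
have [|w _ Uw] := ultra_bigcup_finite (F := fun w => [set i | u i z = w]) UU
  (Gamma_locally_finite y); last by exists w.
apply: filterS Uy => i /= <-; exists (u i z) => //.
by rewrite /neighbours /= u_adj.
Qed.

Lemma ultra_limit_automorphism u x0 y0 :
  (forall i, is_automorphism (u i)) -> (forall i, u i x0 = y0) ->
  exists2 g, is_automorphism g & forall x, U [set i | u i x = g x].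
Proof.
move=> u_aut u0.
have /choice[v uvK] i : exists v, cancel (u i) v /\ cancel v (u i).
  by have [[v uK vK] _] := u_aut i; exists v.
have v_adj i x y : adj (v i x) (v i y) = adj x y.
  by have [uK vK] := uvK i; exact: (automorphism_inv (u_aut i) uK vK).2.
have v0 i : v i y0 = x0 by rewrite -(u0 i) (uvK i).1.
have [g gU] := ultra_limit_exists (fun i => (u_aut i).2) u0.
have [g' g'U] := ultra_limit_exists v_adj v0.
exists g => //; split.
  exists g' => x.
    have [i [/= ug vg']] := filter_ex (filterI (gU x) (g'U (g x))).
    by rewrite -vg' -ug (uvK i).1.
  have [i [/= vg' ug]] := filter_ex (filterI (g'U x) (gU (g' x))).
  by rewrite -ug -vg' (uvK i).2.
move=> x y; have [i [/= <- <-]] := filter_ex (filterI (gU x) (gU y)).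
exact: (u_aut i).2.
Qed.

End PointwiseLimits.

Section ClosedGroups.
Variables (Gamma : graph) (G : set (Gamma -> Gamma)).
Hypotheses (Gamma_connected : connected_graph Gamma)
  (Gamma_locally_finite : locally_finite Gamma)
  (subG : subgroup_Aut G) (G_closed : closed_group G).

Lemma closed_group_accumulation (u : nat -> Gamma -> Gamma) x0 y0 :
  (forall n, G (u n)) -> (forall n, u n x0 = y0) ->
  exists2 g, G g & forall x y, (\forall n \near \oo, u n x = y) -> g x = y.
Proof.
move=> uG u0; have [U [UU ooU]] := ultraFilterLemma eventually_filter.
have [g g_aut gU] := ultra_limit_automorphism (U := U) Gamma_connected
  Gamma_locally_finite (fun n => subgroup_automorphism subG (uG n)) u0.
exists g; last first.
  by move=> x y /ooU Uy; have [n [/= <- <-]] := filter_ex (filterI (gU x) Uy).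
have Gamma_countable : countable [set: Gamma].
  apply: connected_countable => // x; exact: finite_set_countable.
have [phi phiP] := filter_diagonal _ Gamma_countable gU.
exact: (G_closed (u := u \o phi)) (fun n => uG (phi n)) g_aut.1 phiP.
Qed.

Hypothesis G_transitive : forall s, 0 < s -> nbwalk_transitive G s.

Lemma opposite_rays_segment_map f1 f2 h1 h2 n :
  opposite_rays f1 f2 -> opposite_rays h1 h2 ->
  exists2 g, G g & forall i, i <= n -> g (f1 i) = h1 i /\ g (f2 i) = h2 i.
Proof.
move=> [f1_ray f2_ray f0 f12] [h1_ray h2_ray h0 h12].
have [//|||g Gg gE] := @G_transitive (n.+1 + n.+1) _
  (walk_rev_cat n.+1 f1 f2) (walk_rev_cat n.+1 h1 h2);
  [by apply: nbwalk_rev_cat => //; exact: ray_nbwalk..|].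
exists g => // i ni; split.
  have := gE (n.+1 - i); rewrite !walk_rev_catl //; [|lia..].
  by apply; lia.
by have := gE (n.+1 + i); rewrite !walk_rev_catr; apply; lia.
Qed.

Lemma opposite_rays_map f1 f2 h1 h2 :
  opposite_rays f1 f2 -> opposite_rays h1 h2 ->
  exists2 g, G g & g \o f1 = h1 /\ g \o f2 = h2.
Proof.
move=> fP hP.
have /choice[u uP] n : exists g,
    G g /\ forall i, i <= n -> g (f1 i) = h1 i /\ g (f2 i) = h2 i.
  by have [g Gg gE] := opposite_rays_segment_map n fP hP; exists g.
have [||g Gg gE] := @closed_group_accumulation u (f1 0) (h1 0).
- by move=> n; have [] := uP n.
- by move=> n; have [_ /(_ 0 isT)[]] := uP n.
exists g => //; split; apply: funext => i /=; apply: gE; exists i => // n /= ni.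
  by have [_ /(_ i ni)[]] := uP n.
by have [_ /(_ i ni)[]] := uP n.
Qed.

End ClosedGroups.

Lemma tree_two_transitive_on_ends (Gamma : graph) (G : set (Gamma -> Gamma)) :
  is_tree Gamma -> locally_finite Gamma -> subgroup_Aut G -> closed_group G ->
  (forall s, 0 < s -> nbwalk_transitive G s) -> two_transitive_on_ends G.
Proof.
move=> tree fin subG G_closed tr.
move=> e1 e2 e1' e2' e1_end e2_end e1'_end e2'_end e12 e12'.
have [p1 [p2 [pP -> ->]]] := distinct_ends_opposite_rays tree e1_end e2_end e12.
have [q1 [q2 [qP -> ->]]] :=
  distinct_ends_opposite_rays tree e1'_end e2'_end e12'.
have [g Gg [<- <-]] := opposite_rays_map tree.1 fin subG G_closed tr pP qP.
by exists g => //; rewrite !end_act_end_of //; exact: subgroup_automorphism Gg.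
Qed.

Theorem theorem3p1 (Gamma : graph) (G : set (Gamma -> Gamma))
  (hconn : connected_graph Gamma) (htri : trivalent Gamma)
  (hG : subgroup_Aut G)
  (hvert : vertex_transitive G) (harc : arc_transitive G)
  (hstab : forall x : Gamma, infinite_set (stabilizer G x)) :
  is_tree Gamma /\
  (forall s : nat, 1 <= s -> sarc_transitive G s) /\
  (closed_group G -> two_transitive_on_ends G).
Proof.
have trans s : 0 < s -> nbwalk_transitive G s.
  exact: trivalent_nbwalk_transitive.
have tree : is_tree Gamma.
  exact: nbwalk_transitive_is_tree hconn (trivalent_min_degree htri) trans.
split=> //; split=> [s s_gt0|G_closed].
  exact/sarc_transitiveP/trans.
exact: tree_two_transitive_on_ends (trivalent_locally_finite htri) _ _ _.
Qed.
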